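(* Let $(A,\|\cdot\|)$ be an absolute-valued algebra with left unit $e$. Then the following are equivalent: (1) $(x^2,x^2,x^2)=0$ for all $x\in A$; (2) $x^2e=x^2$ for all $x\in A$. Under these conditions $A$ is finite-dimensional of degree $\le 4$, and $(xe)e=x$ for all $x\in A$.
   Context: An absolute-valued algebra is a nonzero real algebra $A$ with a norm satisfying $\|xy\|=\|x\|\|y\|$. The associator is $(x,y,z)=(xy)z-x(yz)$. A left unit $e$ satisfies $ex=x$ for all $x$. The degree of a finite-dimensional algebra is the smallest $n$ such that every single-generated subalgebra has dimension $\le n$. *)

(* Defs.v *)
From HB Require Import structures.
From mathcomp Require Import all_boot all_order all_algebra.
From mathcomp Require Import all_classical all_reals.
From mathcomp Require Import topology normedtype.
Set Implicit Arguments. Unset Strict Implicit. Unset Printing Implicit Defensive.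
Import Order.TTheory GRing.Theory Num.Theory.
Import numFieldNormedType.Exports.
Local Open Scope ring_scope.

Definition bilinear_mul (R : realType) (A : lmodType R) (mul : A -> A -> A) :=
  (forall x y z, mul (x + y) z = mul x z + mul y z) /\
  (forall x y z, mul x (y + z) = mul x y + mul x z) /\
  (forall (a : R) x y, mul (a *: x) y = a *: mul x y) /\
  (forall (a : R) x y, mul x (a *: y) = a *: mul x y).

Definition absolute_valued (R : realType) (A : normedModType R)
  (mul : A -> A -> A) :=
  [/\ bilinear_mul mul, exists x : A, x != 0 &
      forall x y : A, `|mul x y| = `|x| * `|y| ].

Definition associator (R : realType) (A : lmodType R) (mul : A -> A -> A)
  (x y z : A) : A := mul (mul x y) z - mul x (mul y z).

Definition left_unit (R : realType) (A : lmodType R) (mul : A -> A -> A)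
  (e : A) := forall x, mul e x = x.

Definition lin_indep (R : realType) (A : lmodType R) (n : nat)
  (v : 'I_n -> A) :=
  forall c : 'I_n -> R, \sum_(i < n) c i *: v i = 0 -> forall i, c i = 0.

Definition finite_dim (R : realType) (A : lmodType R) :=
  exists n (b : 'I_n -> A), forall x : A,
    exists c : 'I_n -> R, x = \sum_(i < n) c i *: b i.

Definition is_subalgebra (R : realType) (A : lmodType R) (mul : A -> A -> A)
  (S : A -> Prop) :=
  [/\ S 0, (forall a x y, S x -> S y -> S (a *: x + y)) &
      (forall x y, S x -> S y -> S (mul x y))].

Definition gen_subalg (R : realType) (A : lmodType R) (mul : A -> A -> A)
  (x : A) : A -> Prop :=
  fun y => forall S, is_subalgebra mul S -> S x -> S y.

Definition dim_le (R : realType) (A : lmodType R) (S : A -> Prop) (d : nat) :=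
  forall n (v : 'I_n -> A), (forall i, S (v i)) -> lin_indep v -> (n <= d)%N.

Definition degree_le (R : realType) (A : lmodType R) (mul : A -> A -> A)
  (d : nat) := forall x : A, dim_le (gen_subalg mul x) d.

(* Main.v *)
(* Some unit vector [v] of the plane spanned by [e] and [x] satisfies
   [|e + v| = |e - v|]; comparing [(e + v)((e + v)y) - (e - v)((e - v)y) = 4 vy]
   with [(e + v)((e - v)y) = y - v(vy)] gives [|y - v(vy)| = 2|y|] for all [y],
   which forces [v(vy) = -y]. This yields
   [x(xy) = 2 (e|x) xy - |x|^2 y] for all [x], whose polarization shows that the
   norm comes from an inner product. Applied to [u = x^2] with [y = u] and
   [y = e], this identity turns the associator condition into [ue = u].
   If [e] fixes all squares on the right, then [R_e] is an involution, and
   [(x, y) |-> (xe)y] is a unital absolute-valued product, so Hurwitz's argument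
   bounds the dimension. Splitting [x = alpha e + a + b] with [ae = -a] and
   [be = b], the span of [e, a, b, ab] is a subalgebra containing [x]. *)
Require Import Defs.
From HB Require Import structures.
From mathcomp Require Import all_boot all_order all_algebra.
From mathcomp Require Import all_classical all_reals.
From mathcomp Require Import topology normedtype.
From mathcomp Require Import ring lra.
Import Order.TTheory GRing.Theory Num.Theory.
Import numFieldNormedType.Exports.
Local Open Scope ring_scope.

(** * Linear identities in a module, by reflection *)

Section LinearExpressions.
Context {R : comNzRingType} {V : lmodType R}.

Inductive lexpr :=
  | LVar of nat | LZero | LAdd of lexpr & lexpr | LOpp of lexpr
  | LScale of R & lexpr.

Fixpoint leval (s : seq V) (t : lexpr) : V :=
  match t with
  | LVar i => nth 0 s i
  | LZero => 0
  | LAdd t u => leval s t + leval s u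
  | LOpp t => - leval s t
  | LScale a t => a *: leval s t
  end.

Fixpoint lcoef (i : nat) (t : lexpr) : R :=
  match t with
  | LVar j => if Nat.eqb i j then 1 else 0
  | LZero => 0
  | LAdd t u => lcoef i t + lcoef i u
  | LOpp t => - lcoef i t
  | LScale a t => a * lcoef i t
  end.

Lemma leval_coef s t : leval s t = \sum_(i < size s) lcoef i t *: nth 0 s i.
Proof.
elim: t => [j||t IHt u IHu|t IHt|a t IHt] /=.
- have [lt_js|le_sj] := ltnP j (size s); last first.
    rewrite nth_default // big1 // => i _.
    case: PeanoNat.Nat.eqb_spec => [eij|]; last by rewrite scale0r.
    by move: (ltn_ord i); rewrite eij ltnNge le_sj.
  rewrite (bigD1 (Ordinal lt_js)) //= PeanoNat.Nat.eqb_refl scale1r.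
  rewrite big1 ?addr0 //.
  move=> i ne_ij; case: PeanoNat.Nat.eqb_spec => [eij|]; last
    by rewrite scale0r.
  by case/eqP: ne_ij; apply: val_inj.
- by rewrite big1 // => i _; rewrite scale0r.
- by rewrite IHt IHu -big_split; apply: eq_bigr => i _; rewrite scalerDl.
- by rewrite IHt -sumrN; apply: eq_bigr => i _; rewrite scaleNr.
- by rewrite IHt scaler_sumr; apply: eq_bigr => i _; rewrite scalerA.
Qed.

(** For a concrete list of atoms this recursive conjunction computes to finitely many scalar
    equations, each a goal for [ring]. *)
Fixpoint lcoefs_eq (n : nat) (t u : lexpr) : Prop :=
  match n with
  | 0%N => True
  | n'.+1 => lcoef n' t = lcoef n' u /\ lcoefs_eq n' t u
  end.

Lemma leval_eq (s : seq V) t u :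
  lcoefs_eq (size s) t u -> leval s t = leval s u.
Proof.
move=> tu; rewrite !leval_coef; apply: eq_bigr => i _; congr (_ *: _).
move: (size s) tu i => n; elim: n => [|n IHn] /= => [_ [] //|[tu0 tu1] i].
by have := ltn_ord i; rewrite ltnS leq_eqVlt => /predU1P[->//|lt_in];
  apply: (IHn tu1 (Ordinal lt_in)).
Qed.
End LinearExpressions.

Ltac latom_index x l :=
  match l with
  | x :: _ => constr:(0%N)
  | _ :: ?l' => let n := latom_index x l' in constr:(S n)
  end.
Ltac latom_add x l :=
  match l with
  | _ => let n := latom_index x l in constr:(l)
  | _ => constr:(x :: l)
  end.
Ltac latoms t l :=
  match t with
  | ?a + ?b => let l := latoms a l in latoms b l
  | - ?a => latoms a l
  | _ *: ?a => latoms a l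
  | 0 => constr:(l)
  | _ => latom_add t l
  end.
Ltac lreify t l :=
  match t with
  | ?a + ?b => let a' := lreify a l in let b' := lreify b l in
               open_constr:(LAdd a' b')
  | - ?a => let a' := lreify a l in open_constr:(LOpp a')
  | ?k *: ?a => let a' := lreify a l in open_constr:(LScale k a')
  | 0 => open_constr:(LZero)
  | _ => let n := latom_index t l in open_constr:(LVar n)
  end.
(* Equalities of linear combinations in a module, by reflection: compares the
   coefficients of each atom with [ring]. *)
Ltac lmodule :=
  match goal with
  | |- @eq ?V ?t ?u =>
    let l := latoms t (@nil V) in
    let l := latoms u l in
    let t' := lreify t l in
    let u' := lreify u l in
    apply: (@leval_eq _ _ l t' u'); cbn [lcoefs_eq lcoef size Nat.eqb];
    repeat split; ring
  end.

(** * Archimedean bounds on real numbers *)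

Section RealBounds.
Context {R : realType}.

Lemma natmul_bounded_le0 (s C : R) : (forall n, n%:R * s <= C) -> s <= 0.
Proof.
move=> sC; rewrite leNgt; apply/negP => s_gt0.
have := sC (Num.bound `|C / s|); apply/negP; rewrite -ltNge -ltr_pdivrMr //.
exact: le_lt_trans (ler_norm _) (archi_boundP (normr_ge0 _)).
Qed.

(** For [0 < t < s], Bernoulli's inequality makes [(s / t)^n] grow at least linearly, past [C]. *)
Lemma expr_le_of_bounded (C s t : R) :
  0 <= s -> 0 <= t -> (forall n, s ^+ n <= C * t ^+ n) -> s <= t.
Proof.
move=> s0 t0 st; rewrite leNgt; apply/negP => lt_ts.
have [t_eq0|tn0] := eqVneq t 0.
  by have := st 1%N; rewrite !expr1 t_eq0; lra.
have t_gt0 : 0 < t by rewrite lt0r tn0.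
have bern n : 1 + n%:R * (s / t - 1) <= (s / t) ^+ n.
  elim: n => [|n IHn]; first by rewrite expr0 mul0r addr0.
  have lt1 : 1 < s / t by rewrite ltr_pdivlMr // mul1r.
  have n0 : 0 <= n%:R :> R by rewrite ler0n.
  rewrite exprS -natr1; move: IHn lt1 n0.
  move: (s / t) (_ ^+ n) n%:R => u p k IHn lt1 n0.
  have := mulr_ge0 n0 (sqr_ge0 (u - 1)).
  have : 0 <= u * (p - (1 + k * (u - 1))) by apply: mulr_ge0; lra.
  by lra.
suff : s / t - 1 <= 0 by rewrite subr_le0 ler_pdivrMr // mul1r leNgt lt_ts.
apply: (@natmul_bounded_le0 _ C) => n.
have : (s / t) ^+ n <= C by rewrite expr_div_n ler_pdivrMr ?exprn_gt0.
by have := bern n; lra.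
Qed.
End RealBounds.

(* If [M z <> z], put [S = 1 + M + ... + M^n]. Since [1 + M] doubles norms, the
   triangle inequality for [(1 + M)^n] is an equality, hence so is the one for
   [S]; but [S (z - M z) = z - M^(n+1) z] is bounded in [n]. *)
Lemma isometry_eq_id {R : realType} {V : normedModType R} (M : V -> V) :
  {morph M : x y / x + y} -> (forall x, `|M x| = `|x|) ->
  (forall z, 2 * `|z| <= `|z + M z|) -> forall z, M z = z.
Proof.
move=> MD Mn Mge z0.
pose W z := z + M z; pose S n z := iter n (fun y => z + M y) z.
have MB x y : M (x - y) = M x - M y.
  by apply: (addIr (M y)); rewrite -MD !subrK.
have W_ge n z : 2 ^+ n * `|z| <= `|iter n W z|.
  elim: n => [|n IHn] /=; first by rewrite expr0 mul1r.
  by rewrite exprS -mulrA; have := Mge (iter n W z); rewrite /W; lra.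
have S_le n z : `|S n z - z| <= n%:R * `|z|.
  elim: n => [|n IHn] /=; first by rewrite subrr normr0 mul0r.
  rewrite addrAC subrr add0r Mn -natr1.
  by have := ler_normD (S n z - z) z; rewrite subrK; lra.
have WS n z : `|iter n W z - S n z| <= (2 ^+ n - n.+1%:R) * `|z|.
  elim: n => [|n IHn] /=; first by rewrite subrr normr0 expr0 subrr mul0r.
  have -> : W (iter n W z) - (z + M (S n z)) =
      (iter n W z - S n z) + M (iter n W z - S n z) + (S n z - z).
    by rewrite MB /W; lmodule.
  apply: le_trans (ler_normD _ _) _.
  have := ler_normD (iter n W z - S n z) (M (iter n W z - S n z)).
  have := S_le n z.
  by rewrite Mn exprS -(natr1 n.+1) -natr1; move: IHn; rewrite -natr1; lra.
have S_ge n z : n.+1%:R * `|z| <= `|S n z|.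
  have := ler_normD (iter n W z - S n z) (S n z); rewrite subrK.
  by have := W_ge n z; have := WS n z; lra.
have tele n z : S n (z - M z) = z - iter n.+1 M z.
  by elim: n => [//|n /= IHn]; rewrite IHn MB /=; lmodule.
have iterMn n z : `|iter n M z| = `|z| by elim: n => //= n; rewrite Mn.
apply/eqP; rewrite eq_sym -subr_eq0 -normr_le0.
apply: (@natmul_bounded_le0 _ _ (2 * `|z0|)) => -[|n].
  by rewrite mul0r mulr_ge0.
have := S_ge n (z0 - M z0); rewrite tele.
by have := ler_normB z0 (iter n.+1 M z0); rewrite iterMn; lra.
Qed.

(** Polarization of the norm. For the algebra at hand it is shown to be bilinear in [ip_linear],
    starting from the case where one argument is [e]. *)
Definition ip {R : realType} {V : normedModType R} (x y : V) : R :=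
  (`|x + y| ^+ 2 - `|x| ^+ 2 - `|y| ^+ 2) / 2.

(** * Left multiplications in the presence of a left unit *)

Section LeftUnit.
Context {R : realType} {A : normedModType R} {mul : A -> A -> A} {e : A}.
Context (avm : absolute_valued mul) (ue : left_unit mul e).
Local Notation "x ** y" := (mul x y) (at level 40, left associativity).

Lemma av_mulDl x y z : (x + y) ** z = x ** z + y ** z.
Proof. by case: avm => -[]. Qed.

Lemma av_mulDr x y z : x ** (y + z) = x ** y + x ** z.
Proof. by case: avm => -[_ []]. Qed.

Lemma av_mulZl a x y : (a *: x) ** y = a *: (x ** y).
Proof. by case: avm => -[_ [_ []]]. Qed.

Lemma av_mulZr a x y : x ** (a *: y) = a *: (x ** y).
Proof. by case: avm => -[_ [_ []]]. Qed.

Lemma av_norm x y : `|x ** y| = `|x| * `|y|.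
Proof. by case: avm. Qed.

Lemma av_mulNl x y : (- x) ** y = - (x ** y).
Proof. by rewrite -scaleN1r av_mulZl scaleN1r. Qed.

Lemma av_mulNr x y : x ** (- y) = - (x ** y).
Proof. by rewrite -scaleN1r av_mulZr scaleN1r. Qed.

Lemma av_mul0l x : 0 ** x = 0.
Proof. by apply: (addrI (0 ** x)); rewrite -av_mulDl !addr0. Qed.

Lemma av_mul0r x : x ** 0 = 0.
Proof. by apply: (addrI (x ** 0)); rewrite -av_mulDr !addr0. Qed.

Definition avE := (av_mulDl, av_mulDr, av_mulZl, av_mulZr, av_mulNl, av_mulNr,
  av_mul0l, av_mul0r).

Lemma av_mul_eq0 x y : x ** y = 0 -> x = 0 \/ y = 0.
Proof.
move=> /(congr1 Num.norm); rewrite av_norm normr0 => /eqP.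
by rewrite mulf_eq0 !normr_eq0 => /orP[] /eqP; [left|right].
Qed.

Lemma av_norm_unit : `|e| = 1.
Proof.
case: avm => _ [x x0] _; apply: (mulIf (x := `|x|)); rewrite ?normr_eq0 //.
by rewrite -av_norm ue mul1r.
Qed.

Lemma av_unit_neq0 : e != 0.
Proof. by rewrite -normr_eq0 av_norm_unit oner_neq0. Qed.

Lemma parallelogram_ge x : 4 * `|x| <= `|e + x| ^+ 2 + `|e - x| ^+ 2.
Proof.
have eq4 : (e + x) ** ((e + x) ** e) - (e - x) ** ((e - x) ** e) =
    4 *: (x ** e) by rewrite !(avE, ue); lmodule.
have := ler_normB ((e + x) ** ((e + x) ** e)) ((e - x) ** ((e - x) ** e)).
by rewrite eq4 normrZ !av_norm av_norm_unit !mulr1 ger0_norm ?ler0n // !expr2.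
Qed.

(** The map [M = - L_v^2] is an isometry and [1 + M = L_(e+v) L_(e-v)] scales norms by [|e + v|^2],
    which is at least 2 by [parallelogram_ge]. Hence [isometry_eq_id] applies. *)
Lemma isosceles_sqrN1 v : `|v| = 1 -> `|e + v| = `|e - v| ->
  forall y, v ** (v ** y) = - y.
Proof.
move=> v1 iso y; apply: oppr_inj; rewrite opprK.
apply: (isometry_eq_id (fun y => - (v ** (v ** y)))) => [x z|x|z].
- by rewrite !avE opprD.
- by rewrite normrN !av_norm v1 !mul1r.
have -> : z - v ** (v ** z) = (e + v) ** ((e - v) ** z).
  by rewrite !(avE, ue); lmodule.
rewrite !av_norm -iso mulrA -expr2 ler_wpM2r //.
by have := parallelogram_ge v; rewrite v1 -iso; lra.
Qed.

(** Intermediate value theorem in [a]. Scaling [e] by [|w|], instead of normalizing [w], keeps [h]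
    continuous where [w = 0]. *)
Lemma isosceles_exists x : exists a : R,
  let w := x + a *: e in `| `|w| *: e + w| = `| `|w| *: e - w|.
Proof.
pose w a : A := x + a *: e.
pose h a : R := `| `|w a| *: e + w a| - `| `|w a| *: e - w a|.
have cw : continuous w.
  move=> a; apply: cvgD; first exact: cvg_cst.
  exact: cvgZr_tmp.
have ch : continuous h.
  move=> a; apply: cvgB; apply: cvg_norm; [apply: cvgD|apply: cvgB] => //;
    try exact: cw; apply: cvgZr_tmp; apply: cvg_norm; exact: cw.
(* For [m = 2 |x|], the norm of [x + m e] differs from [m] by at most [|x|], whence
   [h m >= 2 m - 4 |x| = 0]; symmetrically [h (- m) <= 0]. *)
have [m mE] : exists m, m = 2 * `|x| by exists (2 * `|x|).
have m0 : 0 <= m by rewrite mE mulr_ge0.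
have : exists2 c, c \in `[- m, m] & h c = 0.
  apply: IVT; first lra.
    exact: continuous_subspaceT.
  have nZe (k : R) : `|k *: e| = `|k| by rewrite normrZ av_norm_unit mulr1.
  have wm : `| `|w m| - m | <= `|x|.
    have := ler_dist_dist (w m) (m *: e).
    by rewrite /w addrK nZe (ger0_norm m0).
  have wNm : `| `|w (- m)| - m | <= `|x|.
    have := ler_dist_dist (w (- m)) (- m *: e).
    by rewrite /w addrK nZe normrN (ger0_norm m0).
  have hm : 0 <= h m.
    have -> : h m = `|(`|w m| + m) *: e + x| - `|(`|w m| - m) *: e - x|.
      by rewrite /h /w; congr (_ - _); congr Num.norm; lmodule.
    have := ler_normB ((`|w m| - m) *: e) x.
    have := ler_normB ((`|w m| + m) *: e + x) x; rewrite addrK !nZe.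
    rewrite (@ger0_norm _ (`|w m| + m)); last by rewrite addr_ge0.
    have : 0 <= `|w m| by [].
    by have := wm; move: wm; rewrite {1}ler_norml => /andP[]; lra.
  have hNm : h (- m) <= 0.
    have -> : h (- m) =
        `|(`|w (- m)| - m) *: e + x| - `|(`|w (- m)| + m) *: e - x|.
      by rewrite /h /w; congr (_ - _); congr Num.norm; lmodule.
    have := ler_normD ((`|w (- m)| - m) *: e) x.
    have := ler_normD ((`|w (- m)| + m) *: e - x) x; rewrite subrK !nZe.
    rewrite (@ger0_norm _ (`|w (- m)| + m)); last by rewrite addr_ge0.
    have : 0 <= `|w (- m)| by [].
    by have := wNm; move: wNm; rewrite {1}ler_norml => /andP[]; lra.
  by rewrite ge_min le_max hm hNm /= orbT.
by case=> c _ /eqP; rewrite subr_eq0 => /eqP hc; exists c.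
Qed.

(* [a + b i |-> |a e + b v|] is multiplicative on the complex numbers, hence
   bounded by the modulus (take powers), hence equal to it (use conjugates). *)
Lemma norm_sqrN1 v a b : (forall y, v ** (v ** y) = - y) ->
  `|a *: e + b *: v| ^+ 2 = a ^+ 2 + b ^+ 2.
Proof.
move=> vv; pose N a b : R := `|a *: e + b *: v|.
have NM p q r s : N p q * N r s = N (p * r - q * s) (p * s + q * r).
  (* Complex multiplication is realized by composing left multiplications, here evaluated at [e]. *)
  have: (p *: e + q *: v) ** ((r *: e + s *: v) ** e) =
      ((p * r - q * s) *: e + (p * s + q * r) *: v) ** e.
    by rewrite !(avE, ue) vv; lmodule.
  by move=> /(congr1 Num.norm); rewrite !av_norm av_norm_unit !mulr1.
have v1 : `|v| = 1.
  have : `|v| ^+ 2 = 1.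
    rewrite expr2 -[LHS]mulr1 -av_norm_unit -mulrA -!av_norm vv normrN.
    by rewrite av_norm_unit.
  by move/eqP; rewrite sqrp_eq1 // => /eqP.
have N_le p q : N p q <= `|p| + `|q|.
  by apply: le_trans (ler_normD _ _) _; rewrite !normrZ av_norm_unit v1 !mulr1.
have NX p q n : exists r s,
    N p q ^+ n = N r s /\ (p ^+ 2 + q ^+ 2) ^+ n = r ^+ 2 + s ^+ 2.
  elim: n => [|n [r [s [IH1 IH2]]]].
    exists 1, 0; rewrite !expr0 /N scale0r addr0 scale1r av_norm_unit.
    by split => //; ring.
  exists (p * r - q * s), (p * s + q * r).
  by rewrite exprS IH1 NM [(_ + _) ^+ n.+1]exprS IH2; split => //; ring.
have N2_le p q : N p q ^+ 2 <= p ^+ 2 + q ^+ 2.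
  (* The constant 2 comes from [(|r| + |s|)^2 <= 2 (r^2 + s^2)] for the coordinates of the n-th
     power. *)
  apply: (@expr_le_of_bounded _ 2) => [||n].
  - exact: sqr_ge0.
  - by rewrite addr_ge0 ?sqr_ge0.
  have [r [s [-> ->]]] : exists r s, (N p q ^+ 2) ^+ n = N r s ^+ 2 /\
      (p ^+ 2 + q ^+ 2) ^+ n = r ^+ 2 + s ^+ 2.
    have [r [s [rs1 rs2]]] := NX p q n; exists r, s; split => //.
    by rewrite -exprM mulnC exprM rs1.
  have : N r s ^+ 2 <= (`|r| + `|s|) ^+ 2.
    by rewrite ler_sqr ?N_le ?nnegrE ?addr_ge0 ?normr_ge0.
  rewrite sqrrD !real_normK ?num_real //.
  have := sqr_ge0 (`|r| - `|s|); rewrite sqrrB !real_normK ?num_real //.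
  by lra.
have := N2_le a b; have := N2_le a (- b); rewrite sqrrN.
have : N a b ^+ 2 * N a (- b) ^+ 2 = (a ^+ 2 + b ^+ 2) ^+ 2.
  rewrite -exprMn NM /N !mulrN opprK [a * b]mulrC addNr scale0r addr0.
  rewrite normrZ av_norm_unit mulr1 -!expr2 ger0_norm ?addr_ge0 ?sqr_ge0 //.
have s0 : 0 <= N a b ^+ 2 := sqr_ge0 _.
rewrite -/(N a b); move: (N a b ^+ 2) (N a (- b) ^+ 2) s0 => s t s0.
have : 0 <= a ^+ 2 + b ^+ 2 by rewrite addr_ge0 ?sqr_ge0.
move: (a ^+ 2 + b ^+ 2) => q q0 st tq sq; apply/eqP; rewrite eq_le sq /=.
have [->//|qn0] := eqVneq q 0.
by rewrite -(@ler_pM2r _ q) ?lt0r ?qn0 // -expr2 -st ler_wpM2l.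
Qed.

(** In isosceles position [w = r v] with [L_v^2 = -1], so [x = - a e + r v] acts as a complex number
    with real part [al] and squared modulus [q]. If [w = 0], then [x] is a multiple of [e]. *)
Lemma av_quadratic_form x : exists al q : R,
  (forall s, `|s *: e + x| ^+ 2 = s ^+ 2 + 2 * s * al + q) /\
  (forall y, x ** (x ** y) = (2 * al) *: (x ** y) - q *: y).
Proof.
have [a] := isosceles_exists x; set w := x + a *: e; move=> /= iso.
have xw : x = w - a *: e by rewrite addrK.
have [w0|wn0] := eqVneq w 0.
  have {}xw : x = - a *: e by rewrite xw w0 scaleNr sub0r.
  exists (- a), (a ^+ 2); split => [s|y]; last
    by rewrite xw !(avE, ue); lmodule.
  rewrite xw -scalerDl normrZ av_norm_unit mulr1 real_normK ?num_real //.
  by ring.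
have r0 : `|w| != 0 by rewrite normr_eq0.
pose v := `|w|^-1 *: w.
have wv : w = `|w| *: v by rewrite /v scalerA divff // scale1r.
have vv : forall y, v ** (v ** y) = - y.
  apply: isosceles_sqrN1.
    by rewrite /v normrZ normfV normr_id mulVf.
  have nwZ z : `|w| * `|z| = `| `|w| *: z| by rewrite normrZ normr_id.
  by apply: (mulfI r0); rewrite !nwZ scalerDr scalerBr -wv.
have {}xw : x = (- a) *: e + `|w| *: v by rewrite -wv {1}xw scaleNr addrC.
clearbody v; move: `|w| xw {iso r0 wv} => r xw.
exists (- a), (a ^+ 2 + r ^+ 2); split => [s|y].
  have -> : s *: e + x = (s - a) *: e + r *: v by rewrite xw; lmodule.
  by rewrite norm_sqrN1 //; ring.
by rewrite xw !(avE, ue) vv; lmodule.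
Qed.

(** The values at [s = 0] and [s = 1] identify [q] and [al] in [av_quadratic_form]. *)
Lemma norm_shift s x :
  `|s *: e + x| ^+ 2 = s ^+ 2 + 2 * s * ip e x + `|x| ^+ 2.
Proof.
have [al [q [nx _]]] := av_quadratic_form x.
have := nx 0; rewrite scale0r add0r => n0.
have := nx 1; rewrite scale1r => n1.
by rewrite nx /ip n0 n1 av_norm_unit; field.
Qed.

Lemma av_sqr x y :
  x ** (x ** y) = (2 * ip e x) *: (x ** y) - `|x| ^+ 2 *: y.
Proof.
have [al [q [nx ->]]] := av_quadratic_form x.
have := nx 0; rewrite scale0r add0r => n0.
have := nx 1; rewrite scale1r => n1.
have -> : q = `|x| ^+ 2 by rewrite n0; ring.
by congr (_ *: _ - _); rewrite /ip n0 n1 av_norm_unit; field.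
Qed.

(** Compares two instances of [norm_shift] through [e + a x = a (a^-1 e + x)]. *)
Lemma ip_unitZ a x : ip e (a *: x) = a * ip e x.
Proof.
have [->|a0] := eqVneq a 0.
  by rewrite scale0r mul0r /ip addr0 normr0 expr0n /= subrr subr0 mul0r.
have := norm_shift a^-1 x; have := norm_shift 1 (a *: x); rewrite scale1r.
have -> : e + a *: x = a *: (a^-1 *: e + x).
  by rewrite scalerDr scalerA divff // scale1r.
rewrite !normrZ !exprMn !real_normK ?num_real // => eq1 eq2.
rewrite eq2 in eq1; apply: (mulfI (x := 2)); first by rewrite pnatr_eq0.
have : a ^+ 2 * a^-1 ^+ 2 = 1 by rewrite -exprMn divff ?expr1n.
have : a ^+ 2 * a^-1 = a by rewrite expr2 mulfK.
move: eq1 => + h1 h2; rewrite !mulrDr h2 expr1n.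
have -> : a ^+ 2 * (2 * a^-1 * ip e x) = 2 * (a ^+ 2 * a^-1) * ip e x by ring.
by rewrite h1; lra.
Qed.

(* Comparing [|2 s e + x + y| <= |s e + x| + |s e + y|] as [s] grows. *)
Lemma ip_unit_subadd x y : ip e (x + y) <= ip e x + ip e y.
Proof.
have ub s z : 0 < s -> `|s *: e + z| <= s + ip e z + `|z| ^+ 2 / (2 * s).
  move=> s0; rewrite -(@ler_pM2l _ (2 * s)) ?mulr_gt0 //.
  have -> : 2 * s * (s + ip e z + `|z| ^+ 2 / (2 * s)) =
    s ^+ 2 + (s ^+ 2 + 2 * s * ip e z + `|z| ^+ 2).
    by field; apply: lt0r_neq0.
  rewrite -norm_shift; have := sqr_ge0 (`|s *: e + z| - s).
  by lra.
have cs z : (ip e z) ^+ 2 <= `|z| ^+ 2.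
  (* This shift minimizes the quadratic; its minimum [|z|^2 - (ip e z)^2] is a square of a norm. *)
  have := norm_shift (- ip e z) z.
  by have := sqr_ge0 `|- ip e z *: e + z|; lra.
have lb s z : s + ip e z <= `|s *: e + z|.
  have [le0|/ltW ge0] := leP (s + ip e z) 0; first exact: le_trans le0 _.
  rewrite -ler_sqr ?nnegrE //; have := cs z; rewrite norm_shift.
  by lra.
rewrite -subr_le0.
apply: (@natmul_bounded_le0 _ _ (`|x| ^+ 2 / 2 + `|y| ^+ 2 / 2)) => -[|n].
  by rewrite mul0r addr_ge0 // divr_ge0 // sqr_ge0.
have s0 : 0 < n.+1%:R :> R by rewrite ltr0n.
move: n.+1%:R s0 => s s0.
have := lb (2 * s) (x + y); have := ub s x s0; have := ub s y s0.
have -> : (2 * s) *: e + (x + y) = (s *: e + x) + (s *: e + y) by lmodule.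
have := ler_normD (s *: e + x) (s *: e + y).
move=> h1 h2 h3 h4.
have h5 : ip e (x + y) - (ip e x + ip e y) <=
  `|x| ^+ 2 / (2 * s) + `|y| ^+ 2 / (2 * s) by lra.
have sq z : s * (`|z| ^+ 2 / (2 * s)) = `|z| ^+ 2 / 2.
  by field; apply: lt0r_neq0.
by rewrite -!sq -mulrDr; exact: (ler_wpM2l (ltW s0) h5).
Qed.

(** A subadditive odd function is additive. *)
Lemma ip_unitD x y : ip e (x + y) = ip e x + ip e y.
Proof.
have ipN z : ip e (- z) = - ip e z by rewrite -scaleN1r ip_unitZ mulN1r.
apply/eqP; rewrite eq_le ip_unit_subadd /=.
by have := ip_unit_subadd (- x) (- y); rewrite -opprD !ipN; lra.
Qed.

Lemma av_polar x z y : x ** (z ** y) + z ** (x ** y) =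
  (2 * ip e x) *: (z ** y) + (2 * ip e z) *: (x ** y) - (2 * ip x z) *: y.
Proof.
have nxz : `|x + z| ^+ 2 = `|x| ^+ 2 + `|z| ^+ 2 + 2 * ip x z.
  by rewrite /ip; field.
have -> : x ** (z ** y) + z ** (x ** y) =
    (x ** (x ** y) + z ** (x ** y) + (x ** (z ** y) + z ** (z ** y)))
    - x ** (x ** y) - z ** (z ** y) by lmodule.
by rewrite -!(av_mulDl, av_mulDr) !av_sqr ip_unitD nxz !avE; lmodule.
Qed.

End LeftUnit.

(** * Spans of finite sequences and dimension bounds *)

Section Span.
Context {R : realType} {V : lmodType R}.

(** Peeling off one coefficient at a time suits induction on [s] and avoids indexed sums. *)
Fixpoint in_span (s : seq V) (x : V) : Prop :=
  if s is v :: s' then exists a : R, in_span s' (x - a *: v) else x = 0.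

Lemma in_span0 s : in_span s 0.
Proof. by elim: s => //= v s IHs; exists 0; rewrite scale0r subr0. Qed.

Lemma in_span_linear s a x y :
  in_span s x -> in_span s y -> in_span s (a *: x + y).
Proof.
elim: s x y => [|v s IHs] x y /= => [->->|[b xs] [c ys]].
  by rewrite scaler0 addr0.
exists (a * b + c); have := IHs _ _ xs ys; congr in_span; lmodule.
Qed.

Lemma in_spanZ s a x : in_span s x -> in_span s (a *: x).
Proof.
by move=> xs; rewrite -[_ *: _]addr0; apply: in_span_linear (in_span0 s).
Qed.

Lemma in_spanN s x : in_span s x -> in_span s (- x).
Proof. by rewrite -scaleN1r; exact: in_spanZ. Qed.

Lemma in_span_mem s v : v \in s -> in_span s v.
Proof.
elim: s => //= u s IHs; rewrite inE => /predU1P[->|/IHs vs].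
  by exists 1; rewrite scale1r subrr; exact: in_span0.
by exists 0; rewrite scale0r subr0.
Qed.

Lemma in_span_ind s (P : V -> Prop) : P 0 ->
  (forall a x y, P x -> P y -> P (a *: x + y)) ->
  (forall v, v \in s -> P v) -> forall x, in_span s x -> P x.
Proof.
move=> P0 PZD; elim: s => [|v s IHs] Ps x /=; first by move->.
move=> [a xs]; rewrite -(subrK (a *: v) x) addrC; apply: PZD.
  by apply: Ps; rewrite inE eqxx.
by apply: IHs xs => u us; apply: Ps; rewrite inE us orbT.
Qed.

Lemma in_span_sum s x : in_span s x ->
  exists c : 'I_(size s) -> R, x = \sum_i c i *: nth 0 s i.
Proof.
elim: s x => [|v s IHs] x /= => [->|[a /IHs[c xc]]].
  by exists (fun=> 0); rewrite big_ord0.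
exists (fun i => oapp c a (unlift ord0 i)).
rewrite big_ord_recl unlift_none /=; apply: (addIr (- (a *: v))).
by rewrite addrAC subrr add0r xc; apply: eq_bigr => i _; rewrite liftK.
Qed.

Lemma finite_dim_in_span s : (forall x, in_span s x) -> finite_dim V.
Proof.
by move=> sT; exists (size s), (fun i => nth 0 s i) => x; apply: in_span_sum.
Qed.

(** With more vectors than [size s], the matrix of their coordinates has a nonzero row kernel, that
    is, a nontrivial linear relation. *)
Lemma dim_le_in_span s (S : V -> Prop) :
  (forall x, S x -> in_span s x) -> dim_le S (size s).
Proof.
move=> Ss n v Sv free_v; rewrite leqNgt; apply/negP => lt_sn.
have /choice[c vc] i := in_span_sum s (v i) (Ss _ (Sv i)).
pose M := \matrix_(i < n, j < size s) c i j.
have : kermx M != 0.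
  rewrite -mxrank_eq0 mxrank_ker -lt0n subn_gt0.
  exact: leq_ltn_trans (rank_leq_col M) lt_sn.
case/rowV0Pn => u /sub_kermxP uM /eqP[]; apply/rowP => k; rewrite mxE.
apply: (free_v (fun i => u 0 i)).
under eq_bigr => i _ do rewrite vc scaler_sumr.
rewrite exchange_big /= big1 // => j _.
under eq_bigr => i _ do rewrite scalerA.
rewrite -scaler_suml; move/rowP/(_ j): uM; rewrite !mxE => uMj.
rewrite [X in X *: _](_ : _ = 0) ?scale0r // -[RHS]uMj.
by apply: eq_bigr => i _; rewrite mxE.
Qed.
End Span.

(** * Bilinearity of [ip], orthogonality and projections *)

Section InnerProduct.
Context {R : realType} {A : normedModType R} {mul : A -> A -> A} {e : A}.
Context (avm : absolute_valued mul) (ue : left_unit mul e).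
Local Notation "x ** y" := (mul x y) (at level 40, left associativity).

Lemma ipC (x y : A) : ip x y = ip y x.
Proof. by rewrite /ip [x + y]addrC addrAC. Qed.

Lemma ipxx (x : A) : ip x x = `|x| ^+ 2.
Proof.
rewrite /ip -mulr2n -scaler_nat normrZ ger0_norm ?ler0n // exprMn.
by field.
Qed.

(** In [av_polar] at [y = e], all terms other than [2 (w|z) e] are linear in [w], and [e] is
    nonzero. *)
Lemma ip_linear a (x y z : A) : ip (a *: x + y) z = a * ip x z + ip y z.
Proof.
have polar w : (2 * ip w z) *: e =
    (2 * ip e w) *: z ** e + (2 * ip e z) *: w ** e
    - (w ** (z ** e) + z ** (w ** e)).
  rewrite (av_polar avm ue) !(av_mulZl avm); lmodule.
have : (2 * ip (a *: x + y) z - 2 * (a * ip x z + ip y z)) *: e = 0.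
  transitivity ((2 * ip (a *: x + y) z) *: e -
    (a *: ((2 * ip x z) *: e) + (2 * ip y z) *: e)); first by lmodule.
  rewrite !polar (ip_unitD avm ue) (ip_unitZ avm ue) !(avE avm); lmodule.
move/eqP; rewrite scaler_eq0 (negPf (av_unit_neq0 avm ue)) orbF => /eqP.
by lra.
Qed.

Lemma ip0l (z : A) : ip 0 z = 0.
Proof. by have := ip_linear 1 0 0 z; rewrite scaler0 addr0; lra. Qed.

Lemma ipDl (x y z : A) : ip (x + y) z = ip x z + ip y z.
Proof. by have := ip_linear 1 x y z; rewrite scale1r mul1r. Qed.

Lemma ipZl a (x z : A) : ip (a *: x) z = a * ip x z.
Proof. by have := ip_linear a x 0 z; rewrite ip0l !addr0. Qed.

Lemma ipNl (x z : A) : ip (- x) z = - ip x z.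
Proof. by rewrite -scaleN1r ipZl mulN1r. Qed.

Lemma ipDr (x y z : A) : ip z (x + y) = ip z x + ip z y.
Proof. by rewrite ![ip z _]ipC ipDl. Qed.

Lemma ipZr a (x z : A) : ip z (a *: x) = a * ip z x.
Proof. by rewrite ![ip z _]ipC ipZl. Qed.

Lemma ipNr (x z : A) : ip z (- x) = - ip z x.
Proof. by rewrite ![ip z _]ipC ipNl. Qed.

Lemma ip_mul2l x y z : ip (x ** y) (x ** z) = `|x| ^+ 2 * ip y z.
Proof. by rewrite /ip -(av_mulDr avm) !(av_norm avm) !exprMn; ring. Qed.

Lemma ip_mul2r x y z : ip (x ** y) (z ** y) = ip x z * `|y| ^+ 2.
Proof. by rewrite /ip -(av_mulDl avm) !(av_norm avm) !exprMn; ring. Qed.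

(** [L_(e+x)] scales the inner product by [|e + x|^2 = 1 + |x|^2]; expanding leaves the cross terms,
    whose sum must vanish. *)
Lemma ip_skew x y z : ip e x = 0 -> ip (x ** y) z = - ip y (x ** z).
Proof.
move=> x0; have := ip_mul2l (e + x) y z; have := norm_shift avm ue 1 x.
rewrite scale1r x0 => ->; rewrite !(av_mulDl avm) !ue !(ipDl, ipDr) ip_mul2l.
by lra.
Qed.

Lemma ip_in_span s (x z : A) :
  in_span s x -> (forall v, v \in s -> ip v z = 0) -> ip x z = 0.
Proof.
move=> xs sz; apply: (in_span_ind s (fun w => ip w z = 0)) xs => //.
  exact: ip0l.
by move=> a w1 w2 h1 h2; rewrite ip_linear h1 h2 mulr0 addr0.
Qed.

(** Gram-Schmidt: both [x] and the new vector [v] are first projected onto the span of the tail. *)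
Lemma orthogonal_projection (s : seq A) (x : A) :
  exists2 y, in_span s y & forall v, v \in s -> ip v (x - y) = 0.
Proof.
elim: s x => [|v s IHs] x; first by exists 0.
have [y ys xy] := IHs x; have [u us vu] := IHs v.
(* If [v] already lies in the span of the tail, then [v - u = 0] and division by zero gives
   [t = 0]. *)
pose t := ip (v - u) (x - y) / ip (v - u) (v - u).
exists (y + t *: (v - u)).
  exists t; rewrite [X in in_span _ X](_ : _ = (- t) *: u + y); last by lmodule.
  exact: in_span_linear.
have orth w : w \in s -> ip w (x - (y + t *: (v - u))) = 0.
  move=> ws; rewrite opprD addrA ipDr xy // ipNr ipZr vu //; ring.
move=> w; rewrite inE => /predU1P[->|/orth//].
rewrite -{1}(subrK u v) ipDl [X in _ + X](_ : _ = 0); last first.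
  exact: ip_in_span orth.
rewrite addr0 opprD addrA ipDr ipNr ipZr /t.
have [->|d0] := eqVneq (v - u) 0; first by rewrite !ip0l; ring.
by rewrite divfK ?subrr // ipxx expf_neq0 // normr_eq0.
Qed.

Lemma span_or_orthogonal (s : seq A) : (forall x, in_span s x) \/
  exists2 m : A, m != 0 & forall v, v \in s -> ip v m = 0.
Proof.
have [?|/existsNP[x xs]] := pselect (forall x, in_span s x); [by left|right].
have [y ys xy] := orthogonal_projection s x; exists (x - y) => //.
by apply: contra_notN xs; rewrite subr_eq0 => /eqP->.
Qed.

Lemma anticommute x z y : ip e x = 0 -> ip e z = 0 -> ip x z = 0 ->
  x ** (z ** y) = - (z ** (x ** y)).
Proof.
move=> x0 z0 xz; apply/eqP; rewrite -addr_eq0 (av_polar avm ue) x0 z0 xz.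
by rewrite mulr0 !scale0r subr0 addr0.
Qed.

(** * Hurwitz's argument for a two-sided unit *)

Section Unital.
Context (re : forall x, x ** e = x).

Lemma mul_anticomm x z : ip e x = 0 -> ip e z = 0 -> ip x z = 0 ->
  x ** z = - (z ** x).
Proof. by move=> x0 z0 xz; have := anticommute x z e x0 z0 xz; rewrite !re. Qed.

Lemma ip_unit_mul x z : ip e x = 0 -> ip x z = 0 -> ip e (x ** z) = 0.
Proof. by move=> x0 xz; rewrite ipC ip_skew // re ipC xz oppr0. Qed.

(** [i(jl) = -i(lj) = l(ij) = -(ij)l]: the middle equality is anticommutation of [L_i] and [L_l],
    the outer ones anticommutation of elements. *)
Lemma antiassociate i j l : ip e i = 0 -> ip e j = 0 -> ip e l = 0 ->
  ip i j = 0 -> ip i l = 0 -> ip j l = 0 -> ip (i ** j) l = 0 ->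
  i ** (j ** l) = - (i ** j ** l).
Proof.
move=> i0 j0 l0 ij il jl ijl.
rewrite (mul_anticomm j l) // (av_mulNr avm) (anticommute i l) // opprK.
by apply: mul_anticomm; rewrite // ?ip_unit_mul // ipC.
Qed.

(* Anti-associativity gives [i(j(lm))] both as [-(ij)(lm) = ((ij)l)m] and as
   [-i((jl)m) = (i(jl))m = -((ij)l)m]. *)
Lemma no_fourth_imaginary i j l m :
  ip e i = 0 -> ip e j = 0 -> ip e l = 0 -> ip i j = 0 -> ip i l = 0 ->
  ip j l = 0 -> ip (i ** j) l = 0 ->
  (forall v, v \in [:: e; i; j; i ** j; l; l ** i; l ** j; l ** (i ** j);
                  j ** l; i ** j ** l; i ** (j ** l)] -> ip v m = 0) ->
  i ** j ** l ** m = 0.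
Proof.
move=> i0 j0 l0 ij il jl ijl m_orth.
have [me mi] : ip e m = 0 /\ ip i m = 0
  by split; apply: m_orth; rewrite !inE eqxx ?orbT.
have [mj mij] : ip j m = 0 /\ ip (i ** j) m = 0
  by split; apply: m_orth; rewrite !inE eqxx ?orbT.
have [ml mli] : ip l m = 0 /\ ip (l ** i) m = 0
  by split; apply: m_orth; rewrite !inE eqxx ?orbT.
have [mlj mlij] : ip (l ** j) m = 0 /\ ip (l ** (i ** j)) m = 0
  by split; apply: m_orth; rewrite !inE eqxx ?orbT.
have [mjl mijl] : ip (j ** l) m = 0 /\ ip (i ** j ** l) m = 0
  by split; apply: m_orth; rewrite !inE eqxx ?orbT.
have mijl' : ip (i ** (j ** l)) m = 0 by apply: m_orth; rewrite !inE eqxx ?orbT.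
have ij0 : ip e (i ** j) = 0 by rewrite ip_unit_mul.
have jl0 : ip e (j ** l) = 0 by rewrite ip_unit_mul.
(* Since [L_l] is skew, the entries [l v] of the list make [l m] orthogonal to [i], [j] and [ij]. *)
have lm_orth v : ip (l ** v) m = 0 -> ip v (l ** m) = 0.
  by rewrite ip_skew // => /eqP; rewrite oppr_eq0 => /eqP.
have i_jl : ip i (j ** l) = 0.
  by rewrite ipC ip_skew // (mul_anticomm j i) // 1?ipC // ipNl ijl !oppr0.
have p1 : i ** (j ** (l ** m)) = i ** j ** l ** m.
  rewrite (antiassociate i j) ?ip_unit_mul ?lm_orth //.
  by rewrite (antiassociate (i ** j) l) // opprK.
have p2 : i ** (j ** (l ** m)) = - (i ** j ** l ** m).
  rewrite (antiassociate j l) // (av_mulNr avm) (antiassociate i (j ** l)) //.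
  by rewrite opprK (antiassociate i j l) // (av_mulNl avm).
rewrite p1 in p2; move/eqP: p2; rewrite -addr_eq0 -mulr2n -scaler_nat.
by rewrite scaler_eq0 pnatr_eq0 => /eqP.
Qed.

(** If none of the successive lists spans, nonzero [i], [j], [l], [m] arise with [((ij)l)m = 0],
    against multiplicativity of the norm. *)
Lemma unital_absolute_valued_finite_dim : finite_dim A.
Proof.
suff [s] : exists s : seq A, forall x, in_span s x by exact: finite_dim_in_span.
have [|[i i_n0 i_orth]] := span_or_orthogonal [:: e]; first by exists [:: e].
have [|[j j_n0 j_orth]] := span_or_orthogonal [:: e; i].
  by exists [:: e; i].
have [|[l l_n0 l_orth]] := span_or_orthogonal [:: e; i; j; i ** j].
  by exists [:: e; i; j; i ** j].
have [|[m m_n0 m_orth]] := span_or_orthogonal [:: e; i; j; i ** j; l; l ** i;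
  l ** j; l ** (i ** j); j ** l; i ** j ** l; i ** (j ** l)];
  first by eexists; eassumption.
have : i ** j ** l ** m = 0.
  apply: no_fourth_imaginary => //;
    by [apply: i_orth; rewrite !inE eqxx ?orbT
       |apply: j_orth; rewrite !inE eqxx ?orbT
       |apply: l_orth; rewrite !inE eqxx ?orbT].
move/eqP; rewrite -normr_eq0 !(av_norm avm) !mulf_eq0 !normr_eq0.
by rewrite (negPf i_n0) (negPf j_n0) (negPf l_n0) (negPf m_n0).
Qed.
End Unital.
End InnerProduct.

(** * The associator condition and algebras whose squares are fixed by [R_e] *)

Section FixedSquares.
Context {R : realType} {A : normedModType R} {mul : A -> A -> A} {e : A}.
Context (avm : absolute_valued mul) (ue : left_unit mul e).
Local Notation "x ** y" := (mul x y) (at level 40, left associativity).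

(** Cancelling [u] on the right gives [u^2 - 2(e|u) u + |u|^2 e = 0], and by [av_sqr] at [y = e] the
    left side factors as [(u - 2(e|u) e)(u - ue)]. If the first factor vanishes, [u] is a multiple
    of [e]. *)
Lemma fixed_of_associator u : associator mul u u u = 0 -> u ** e = u.
Proof.
move=> /eqP; rewrite /associator subr_eq0 (av_sqr avm ue) => /eqP uuu.
have [->|u0] := eqVneq u 0; first by rewrite (av_mul0l avm).
have : (u ** u - (2 * ip e u) *: u + `|u| ^+ 2 *: e) ** u = 0.
  by rewrite !(avE avm) uuu ue; lmodule.
case/(av_mul_eq0 avm) => [uu|/eqP]; last by rewrite (negPf u0).
have : (u - (2 * ip e u) *: e) ** (u - u ** e) = 0.
  have -> : (u - (2 * ip e u) *: e) ** (u - u ** e) =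
      u ** u - (2 * ip e u) *: u + `|u| ^+ 2 *: e.
    by rewrite !(avE avm) (av_sqr avm ue) !ue; lmodule.
  exact: uu.
case/(av_mul_eq0 avm) => /eqP; rewrite subr_eq0 => /eqP uE; last by [].
by rewrite {1 2}uE (av_mulZl avm) ue.
Qed.


(** [av_sqr] at [y = e] makes [u^2] a combination of [u] and [e]; multiplying it by [u] on the right
    reproduces [av_sqr] at [y = u]. *)
Lemma associator_of_fixed u : u ** e = u -> associator mul u u u = 0.
Proof.
move=> uu; have sqr : u ** u = (2 * ip e u) *: u - `|u| ^+ 2 *: e.
  by have := av_sqr avm ue u e; rewrite !uu.
rewrite /associator (av_sqr avm ue) {1}sqr !(avE avm) ue; lmodule.
Qed.

Context (fixed_sqr : forall x, x ** x ** e = x ** x).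

Lemma fixed_jordan x y : (x ** y + y ** x) ** e = x ** y + y ** x.
Proof.
have := fixed_sqr (x + y); rewrite !(avE avm) !fixed_sqr => h.
apply: (addrI (x ** x)); apply: (addIr (y ** y)).
transitivity (x ** x + x ** y ** e + (y ** x ** e + y ** y)); first by lmodule.
by rewrite h; lmodule.
Qed.

(** Linearizing the fixed squares at [x] and [e] gives [(xe + x)e = xe + x]. *)
Lemma right_unit_involutive x : x ** e ** e = x.
Proof.
have := fixed_jordan x e; rewrite !(avE avm) ue => h.
by apply: (addIr (x ** e)); rewrite h addrC.
Qed.

Lemma fixed_squares_finite_dim : finite_dim A.
Proof.
(* [e] is a left unit of [circ] because [ee = e], and a right unit because [R_e] is an
   involution. *)
pose circ x y := (x ** e) ** y.
have circ_av : absolute_valued circ.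
  split; last first.
  - by move=> x y; rewrite /circ !(av_norm avm) (av_norm_unit avm ue) mulr1.
  - by exists e; apply: (av_unit_neq0 avm ue).
  - by split; [|split; [|split]] => *; rewrite /circ !(avE avm).
apply: (@unital_absolute_valued_finite_dim _ _ circ e circ_av) => x.
  by rewrite /circ !ue.
exact: right_unit_involutive.
Qed.

Lemma in_span_mul s x y :
  (forall u v, u \in s -> v \in s -> in_span s (u ** v)) ->
  in_span s x -> in_span s y -> in_span s (x ** y).
Proof.
move=> sM xs ys; apply: (in_span_ind s (fun x => in_span s (x ** y))) xs.
- by rewrite (av_mul0l avm); exact: in_span0.
- by move=> a x1 x2 h1 h2; rewrite !(avE avm); exact: in_span_linear.
move=> u us; apply: (in_span_ind s (fun y => in_span s (u ** y))) ys.
- by rewrite (av_mul0r avm); exact: in_span0.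
- by move=> a x1 x2 h1 h2; rewrite !(avE avm); exact: in_span_linear.
by move=> v; exact: sM.
Qed.

(** [R_e] is an isometry, so its eigenspaces for 1 and -1 are orthogonal. With [c = ab] in the
    former, every product of two among [e, a, b, c] is a multiple of one of them. *)
Lemma eigen_span_mul_closed a b : a ** e = - a -> b ** e = b -> ip e b = 0 ->
  forall x y, let s := [:: e; a; b; a ** b] in
  in_span s x -> in_span s y -> in_span s (x ** y).
Proof.
move=> ae be b0 x y s; apply: in_span_mul => {x y}.
have eig_e : ip (a ** e) (e ** e) = ip a e * 1.
  by rewrite (ip_mul2r avm) (av_norm_unit avm ue) expr1n.
have a0 : ip e a = 0.
  by rewrite (ipC e); move: eig_e; rewrite ae (ue e) (ipNl avm ue); lra.
have ab0 : ip a b = 0.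
  have : ip (a ** e) (b ** e) = ip a b * 1.
    by rewrite (ip_mul2r avm) (av_norm_unit avm ue) expr1n.
  by rewrite ae be (ipNl avm ue); lra.
(* [L_a] and [L_b] anticommute; at [e] the sign in [ae = -a] turns this into commutation of [a] and
   [b]. *)
have ba : b ** a = a ** b.
  have := anticommute avm ue a b e a0 b0 ab0; rewrite ae be (av_mulNr avm).
  by rewrite opprK.
have sqr z y : ip e z = 0 -> z ** (z ** y) = - (`|z| ^+ 2 *: y).
  by move=> z0; rewrite (av_sqr avm ue) z0 mulr0 scale0r sub0r.
pose c := a ** b.
have ce : c ** e = c.
  have := fixed_jordan a b; rewrite ba -/c -mulr2n -scaler_nat (av_mulZl avm).
  by apply: scalerI; rewrite pnatr_eq0.
have c0 : ip e c = 0.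
  by rewrite ipC (ip_skew avm ue) // ae (ipNr avm ue) ipC ab0 !oppr0.
have ac0 : ip a c = 0.
  have : ip (a ** e) (a ** b) = 0 by rewrite (ip_mul2l avm) b0 mulr0.
  by rewrite ae (ipNl avm ue) -/c; lra.
have bc0 : ip b c = 0.
  have : ip (b ** e) (b ** a) = 0 by rewrite (ip_mul2l avm) a0 mulr0.
  by rewrite be ba.
have ca : c ** a = a ** c.
  have := anticommute avm ue a c e a0 c0 ac0; rewrite ae ce (av_mulNr avm).
  by rewrite opprK.
have cb : c ** b = - (b ** c).
  by have := anticommute avm ue c b e c0 b0; rewrite ce be ipC => ->.
have aa : a ** a = `|a| ^+ 2 *: e.
  by apply: oppr_inj; rewrite -(av_mulNr avm) -ae sqr.
have bb : b ** b = - (`|b| ^+ 2 *: e) by rewrite -{2}be sqr.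
have cc : c ** c = - (`|c| ^+ 2 *: e) by rewrite -{2}ce sqr.
have ac : a ** c = - (`|a| ^+ 2 *: b) by rewrite sqr.
have bc : b ** c = - (`|b| ^+ 2 *: a).
  rewrite /c (anticommute avm ue b a) // 1?ipC // bb (av_mulNr avm) opprK.
  by rewrite (av_mulZr avm) ae scalerN.
have se : in_span s e by apply: in_span_mem; rewrite !inE eqxx ?orbT.
have sa : in_span s a by apply: in_span_mem; rewrite !inE eqxx ?orbT.
have sb : in_span s b by apply: in_span_mem; rewrite !inE eqxx ?orbT.
have sc : in_span s c by apply: in_span_mem; rewrite !inE eqxx ?orbT.
move=> u v; rewrite !inE -/c => /or4P[] /eqP-> /or4P[] /eqP->;
  rewrite ?ue ?ae ?be ?ce ?ba ?ca ?cb ?aa ?bb ?cc ?ac ?bc ?opprK -?/c //;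
  by do ?[apply: in_spanN|apply: in_spanZ].
Qed.

Lemma fixed_squares_degree_le4 : degree_le mul 4.
Proof.
move=> x; pose al := ip e x.
(* The components of [x] for the eigenvalues -1 and 1 of [R_e]; subtracting [al e] makes [b]
   orthogonal to [e]. *)
pose a := 2^-1 *: (x - x ** e); pose b := 2^-1 *: (x + x ** e) - al *: e.
have ae : a ** e = - a.
  by rewrite /a !(avE avm) right_unit_involutive; lmodule.
have be : b ** e = b.
  by rewrite /b !(avE avm) right_unit_involutive ue; lmodule.
have b0 : ip e b = 0.
  have eTx : ip e (x ** e) = al.
    by rewrite -{1}(ue e) (ip_mul2r avm) (av_norm_unit avm ue) expr1n mulr1.
  rewrite /b (ipDr avm ue) (ipNr avm ue) !(ipZr avm ue) (ipDr avm ue) eTx.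
  by rewrite ipxx (av_norm_unit avm ue) -/al; field.
have := eigen_span_mul_closed a b ae be b0 => /= sM.
apply: (dim_le_in_span [:: e; a; b; a ** b]) => y; apply; last first.
  have -> : x = a + (al *: e + b).
    rewrite /a /b; transitivity ((2^-1 + 2^-1) *: x); last by lmodule.
    by rewrite -[LHS]scale1r; congr (_ *: _); field.
  clearbody a b; rewrite -[X in X + _]scale1r; do ?apply: in_span_linear;
    apply: in_span_mem;
    by rewrite !inE eqxx ?orbT.
split; [exact: in_span0|by move=> *; exact: in_span_linear|exact: sM].
Qed.
End FixedSquares.

Theorem theorem3 (R : realType) (A : normedModType R) (mul : A -> A -> A)
  (e : A) :
  absolute_valued mul -> left_unit mul e ->
  ((forall x : A, associator mul (mul x x) (mul x x) (mul x x) = 0) <->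
   (forall x : A, mul (mul x x) e = mul x x)) /\
  ((forall x : A, mul (mul x x) e = mul x x) ->
   [/\ finite_dim A, degree_le mul 4 & forall x : A, mul (mul x e) e = x]).
Proof.
move=> avm ue; split; first split=> [assoc0 x|fixed x].
- exact: fixed_of_associator avm ue _ (assoc0 x).
- exact: associator_of_fixed avm ue _ (fixed x).
move=> fixed; split.
- exact: fixed_squares_finite_dim avm ue fixed.
- exact: fixed_squares_degree_le4 avm ue fixed.
- exact: right_unit_involutive avm ue fixed.
Qed.
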